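(* For a word $\sigma=\sigma_1\cdots\sigma_n$ over $\{1,\dots,k\}$, say $\sigma$ avoids $12\text{-}3$ if there are no indices $i,j$ with $j>i+1$ and $\sigma_i<\sigma_{i+1}<\sigma_j$, and $\sigma$ avoids $21\text{-}3$ if there are no indices $i,j$ with $j>i+1$ and $\sigma_{i+1}<\sigma_i<\sigma_j$. Let $[k]^n(\tau)$ be the set of words of length $n$ over $\{1,\dots,k\}$ avoiding $\tau$, and $F_\tau(x;k)=\sum_{n\ge0}|[k]^n(\tau)|x^n$. Then the patterns $12\text{-}3$ and $21\text{-}3$ are Wilf-equivalent (i.e. $|[k]^n(12\text{-}3)|=|[k]^n(21\text{-}3)|$ for all $k,n$), and for all $k\ge1$, \[ F_{12\text{-}3}(x;k)=F_{21\text{-}3}(x;k)=\prod_{j=0}^{k-1}\frac{1}{1-\frac{x}{(1-x)^j}}. \]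
   Context: The empty word (length $0$) is counted once. *)

(* Defs.v *)
From HB Require Import structures.
From mathcomp Require Import all_boot all_order all_algebra.
From mathcomp Require Import boolp.

Set Implicit Arguments.
Unset Strict Implicit.
Unset Printing Implicit Defensive.

Import GRing.Theory.
Local Open Scope ring_scope.

(* Formal power series R[[x]], as a commutative unit ring. The record keeps
   [fps R] apart from the function type [nat -> R], whose ring structure (when
   present) is the pointwise one. *)

Record fps (R : Type) : Type := FPS { coefs : nat -> R }.

Lemma fpsP (R : Type) (f g : fps R) : coefs f =1 coefs g -> f = g.
Proof. by case: f g => [f] [g] /= /funext ->. Qed.

HB.instance Definition _ (R : Type) := gen_eqMixin (fps R).
HB.instance Definition _ (R : Type) := gen_choiceMixin (fps R).

Section FpsRing.
Variable R : comUnitRingType.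
Implicit Types (f g h : fps R).

Definition fps0 : fps R := FPS (fun=> 0).
Definition fps_opp f : fps R := FPS (fun n => - coefs f n).
Definition fps_add f g : fps R := FPS (fun n => coefs f n + coefs g n).
Definition fps1 : fps R := FPS (fun n => (n == 0%N)%:R).
Definition fps_mul f g : fps R :=
  FPS (fun n => \sum_(i < n.+1) coefs f i * coefs g (n - i)%N).

Lemma fps_addA : associative fps_add.
Proof. by move=> f g h; apply: fpsP => n /=; rewrite addrA. Qed.
Lemma fps_addC : commutative fps_add.
Proof. by move=> f g; apply: fpsP => n /=; rewrite addrC. Qed.
Lemma fps_add0 : left_id fps0 fps_add.
Proof. by move=> f; apply: fpsP => n /=; rewrite add0r. Qed.
Lemma fps_addN : left_inverse fps0 fps_opp fps_add.
Proof. by move=> f; apply: fpsP => n /=; rewrite addNr. Qed.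

HB.instance Definition _ :=
  GRing.isZmodule.Build (fps R) fps_addA fps_addC fps_add0 fps_addN.

Definition fps_trunc N f : {poly R} := \poly_(i < N) coefs f i.

Lemma coef_fps_mul N f g n : (n < N)%N ->
  coefs (fps_mul f g) n = (fps_trunc N f * fps_trunc N g)`_n.
Proof.
move=> nN; rewrite coefM /=; apply: eq_bigr => i _; rewrite !coef_poly.
by rewrite (leq_ltn_trans (leq_subr _ _) nN) (leq_ltn_trans _ nN) // -ltnS.
Qed.

Lemma fps_mulC : commutative fps_mul.
Proof. by move=> f g; apply: fpsP => n; rewrite !(@coef_fps_mul n.+1) // mulrC. Qed.

Lemma fps_mulA : associative fps_mul.
Proof.
move=> f g h; apply: fpsP => n.
transitivity ((fps_trunc n.+1 f * (fps_trunc n.+1 g * fps_trunc n.+1 h))`_n).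
  rewrite coefM; apply: eq_bigr => i _; rewrite coef_poly ltn_ord.
  by rewrite (@coef_fps_mul n.+1) // ltnS leq_subr.
rewrite mulrA coefM; apply: eq_bigr => i _.
by rewrite (@coef_fps_mul n.+1) // coef_poly ltnS leq_subr.
Qed.

Lemma fps_mul1 : left_id fps1 fps_mul.
Proof.
move=> f; apply: fpsP => n /=; rewrite big_ord_recl /= mul1r subn0.
by rewrite big1 ?addr0 // => i _; rewrite mul0r.
Qed.

Lemma fps_mulDl : left_distributive fps_mul fps_add.
Proof.
move=> f g h; apply: fpsP => n /=; rewrite -big_split /=.
by apply: eq_bigr => i _; rewrite mulrDl.
Qed.

Lemma fps1_neq0 : fps1 != 0 :> fps R.
Proof.
by apply/eqP => /(congr1 (fun f => coefs f 0%N)) /= /eqP; rewrite oner_eq0.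
Qed.

HB.instance Definition _ := GRing.Zmodule_isComNzRing.Build (fps R)
  fps_mulA fps_mulC fps_mul1 fps_mulDl fps1_neq0.

(* The coefficients of g = 1 / f are determined by f_0 g_0 = 1 and
   \sum_(i <= n) f_(n - i) g_i = 0 for n > 0; [fps_inv_seq f n] lists the first
   n of them. *)
Fixpoint fps_inv_seq f n : seq R :=
  if n is m.+1 then
    let s := fps_inv_seq f m in
    rcons s ((coefs f 0%N)^-1 *
      ((m == 0%N)%:R - \sum_(i < m) coefs f (m - i)%N * s`_i))
  else [::].

Definition fps_unit : pred (fps R) := fun f => coefs f 0%N \is a GRing.unit.

Definition fps_inv f : fps R :=
  if fps_unit f then FPS (fun n => (fps_inv_seq f n.+1)`_n) else f.

Lemma size_fps_inv_seq f n : size (fps_inv_seq f n) = n.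
Proof. by elim: n => //= n IHn; rewrite size_rcons IHn. Qed.

Lemma nth_fps_inv_seq f n i :
  (i < n)%N -> (fps_inv_seq f n)`_i = (fps_inv_seq f i.+1)`_i.
Proof.
elim: n => // n IHn; rewrite ltnS leq_eqVlt => /predU1P[->//|lt_in].
by rewrite [fps_inv_seq f n.+1]/= nth_rcons size_fps_inv_seq lt_in IHn.
Qed.

Lemma fps_mulV : {in fps_unit, left_inverse 1 fps_inv *%R}.
Proof.
move=> f f0U; rewrite mulrC; apply: fpsP => n.
rewrite /fps_inv [fps_unit f]f0U [LHS]/= big_ord_recl [nat_of_ord _]/= subn0.
set s := fps_inv_seq f n.
have -> : (fps_inv_seq f n.+1)`_n =
  (coefs f 0%N)^-1 * ((n == 0%N)%:R - \sum_(i < n) coefs f (n - i)%N * s`_i).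
  by rewrite /= nth_rcons size_fps_inv_seq ltnn eqxx.
rewrite mulVKr //.
suff -> : \sum_(i < n) coefs f (lift ord0 i)
    * (fps_inv_seq f (n - lift ord0 i).+1)`_(n - lift ord0 i)
  = \sum_(i < n) coefs f (n - i)%N * s`_i by rewrite subrK.
rewrite (reindex_inj rev_ord_inj) /=; apply: eq_bigr => i _.
have E : (bump 0 (n - i.+1) = n - i)%N by rewrite /bump /= add1n subnSK.
by rewrite !E subKn ?(ltnW (ltn_ord i)) // /s (@nth_fps_inv_seq f n).
Qed.

Lemma fps_unitP f g : g * f = 1 -> fps_unit f.
Proof.
move=> /(congr1 (fun h => coefs h 0%N)) /=; rewrite big_ord1 subn0 => gf1.
by apply/unitrPr; exists (coefs g 0%N); rewrite mulrC.
Qed.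

Lemma fps_inv_out : {in [predC fps_unit], fps_inv =1 id}.
Proof.
move=> f; rewrite inE /fps_inv => /negbTE; rewrite unfold_in => f0NU.
by rewrite /fps_unit f0NU.
Qed.

HB.instance Definition _ := GRing.ComNzRing_hasMulInverse.Build (fps R)
  fps_mulV fps_unitP fps_inv_out.

Definition fpsX : fps R := FPS (fun n => (n == 1%N)%:R).

End FpsRing.

Arguments fpsX {R}.

(* Words of length n are n-tuples over the alphabet 'I_k = {0, ..., k-1}, the
   letter a standing for a + 1. *)

Definition contains_12_3 (k n : nat) (w : n.-tuple 'I_k) : bool :=
  [exists i : 'I_n, exists i1 : 'I_n, exists j : 'I_n,
    [&& i1 == i.+1 :> nat, i.+1 < j,
        tnth w i < tnth w i1 & tnth w i1 < tnth w j]]%N.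

Definition contains_21_3 (k n : nat) (w : n.-tuple 'I_k) : bool :=
  [exists i : 'I_n, exists i1 : 'I_n, exists j : 'I_n,
    [&& i1 == i.+1 :> nat, i.+1 < j,
        tnth w i1 < tnth w i & tnth w i < tnth w j]]%N.

Definition pattern : Type := forall k n : nat, n.-tuple 'I_k -> bool.

Definition avoiders (contains : pattern) (k n : nat) : {set n.-tuple 'I_k} :=
  [set w | ~~ contains k n w].

Definition wilf_equiv (p q : pattern) : Prop :=
  forall k n : nat, #|avoiders p k n| = #|avoiders q k n|.

Definition avoid_gf (p : pattern) (k : nat) : fps rat :=
  FPS (fun n => #|avoiders p k n|%:R).

(* Main.v *)
Require Import Defs.
From mathcomp Require Import all_boot all_order all_algebra.

Import GRing.Theory.
Local Open Scope ring_scope.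

(** Split a word over {0, ..., k} at the first occurrence of its largest
    possible letter k: it is either a word over {0, ..., k-1} or u k v with u over
    {0, ..., k-1}. In the second case k is larger than every letter of u, while it
    cannot play the role of a smaller letter of the pattern; so u k v avoids the
    pattern iff u is weakly monotone and v avoids the pattern. As weakly monotone
    words over k letters have generating function 1 / (1 - x)^k in both
    directions, F_(k+1) = F_k + x / (1 - x)^k F_(k+1) for both patterns. *)

(** * Counting words by length *)

(** [P] reads letters as natural numbers, so one predicate serves every alphabet size. *)
Fixpoint word_count (k n : nat) (P : pred (seq nat)) : nat :=
  if n is m.+1 then \sum_(a < k) word_count k m (fun s => P (val a :: s))
  else P [::].

Definition word_gf (k : nat) (P : pred (seq nat)) : fps rat :=
  FPS (fun n => (word_count k n P)%:R).

Lemma card_word_count (k n : nat) (P : pred (seq nat)) :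
  #|[set w : n.-tuple 'I_k | P (map val w)]| = word_count k n P.
Proof.
rewrite cardsE -sum1_card; elim: n P => [|n IHn] P.
  rewrite (eq_bigl (fun=> P [::])) => [|w]; last by rewrite tuple0.
  rewrite /=; case: (P [::]); last by rewrite big_pred0_eq.
  by rewrite (big_pred1 [tuple]) // => w; rewrite [w]tuple0 /= eqxx.
pose cons_pair (p : 'I_k * n.-tuple 'I_k) := [tuple of p.1 :: p.2].
pose uncons (w : n.+1.-tuple 'I_k) := (thead w, [tuple of behead w]).
rewrite (reindex cons_pair); last first.
  exists uncons => [[a w] _|w _]; last by rewrite [RHS]tuple_eta.
  by congr pair; apply: val_inj.
rewrite /= -(pair_big_dep xpredT (fun a w => P (val a :: map val (tval w)))
  (fun _ _ => 1%N)) /=.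
by apply: eq_bigr => a _; rewrite -IHn.
Qed.

Lemma eq_in_word_count (k n : nat) (P Q : pred (seq nat)) :
  (forall s, all (gtn k) s -> P s = Q s) -> word_count k n P = word_count k n Q.
Proof.
elim: n P Q => [|n IHn] P Q eqPQ /=; first by rewrite eqPQ.
apply: eq_bigr => a _; apply: IHn => s sk.
by apply: eqPQ; rewrite /= ltn_ord.
Qed.

Lemma word_count_andl (k n : nat) (b : bool) (P : pred (seq nat)) :
  word_count k n (fun s => b && P s) = (b * word_count k n P)%N.
Proof.
elim: n P => [|n IHn] P /=; first by rewrite mulnb.
by rewrite big_distrr; apply: eq_bigr => a _; rewrite IHn.
Qed.

(** By induction on [n], looking at the first letter: the letter [k] gives the term [i = 0], a
    smaller one is absorbed into [P] and [Q]. The index [i] is the length of the prefix [u]. *)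
Lemma word_count_split (k n : nat) (P Q R : pred (seq nat)) :
    (forall u v, all (gtn k) u -> all (gtn k.+1) v ->
       P (u ++ k :: v) = Q u && R v) ->
  word_count k.+1 n P = (word_count k n P +
    \sum_(i < n) word_count k i Q * word_count k.+1 (n - i.+1) R)%N.
Proof.
elim: n P Q => [|n IHn] P Q splitP; first by rewrite big_ord0 addn0.
rewrite [LHS]/= big_ord_recr /=.
rewrite (eq_in_word_count _ _ _ (fun s => Q [::] && R s)); last first.
  by move=> s sk; apply: (splitP [::]).
rewrite word_count_andl.
rewrite (eq_bigr (fun a : 'I_k => word_count k n (fun s => P (val a :: s)) +
  \sum_(i < n) word_count k i (fun s => Q (val a :: s)) *
     word_count k.+1 (n - i.+1) R))%N; last first.
  move=> a _; apply: (IHn _ (fun s => Q (val a :: s))) => u v uk vk.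
  by rewrite -splitP //= ltn_ord.
rewrite big_split -addnA big_ord_recl subn1; congr addn.
rewrite addnC exchange_big; congr addn; apply: eq_bigr => i _.
by rewrite -big_distrl.
Qed.

Lemma word_gf_split (k : nat) (P Q R : pred (seq nat)) :
    (forall u v, all (gtn k) u -> all (gtn k.+1) v ->
       P (u ++ k :: v) = Q u && R v) ->
  word_gf k.+1 P = word_gf k P + fpsX * (word_gf k Q * word_gf k.+1 R).
Proof.
move=> splitP; apply: fpsP => n.
rewrite [LHS]/= (word_count_split _ _ _ _ _ splitP) natrD [RHS]/=; congr (_ + _).
case: n => [|n]; first by rewrite /= big_ord0 big_ord1 mul0r.
(* Only the coefficient of [fpsX] at index 1 survives; it accounts for the letter [k]. *)
rewrite natr_sum [RHS]big_ord_recl mul0r add0r.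
rewrite [RHS]big_ord_recl mul1r [X in _ = _ + X]big1 => [|i _].
  by rewrite addr0 subn1; apply: eq_bigr => i _; rewrite natrM subSS.
by rewrite mul0r.
Qed.

Lemma eq_in_word_gf (k : nat) (P Q : pred (seq nat)) :
  (forall s, all (gtn k) s -> P s = Q s) -> word_gf k P = word_gf k Q.
Proof. by move=> eqPQ; apply: fpsP => n /=; rewrite (eq_in_word_count _ _ _ Q). Qed.

Lemma word_gf_nilp (k : nat) : word_gf k (@nilp nat) = 1.
Proof.
apply: fpsP => -[|n] //=; rewrite big1 // => a _.
(* After a first letter, [nilp] is constantly false. *)
by have /= -> := word_count_andl k n false xpredT.
Qed.

Lemma word_gf0 (P : pred (seq nat)) : P [::] -> word_gf 0 P = 1.
Proof. by move=> P0; rewrite -(word_gf_nilp 0); apply: eq_in_word_gf => -[]. Qed.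

Lemma fps_one_subX_mul_unit (f : fps rat) : 1 - fpsX * f \is a GRing.unit.
Proof.
have c0 : coefs (1 - fpsX * f) 0 = 1 by rewrite /= big_ord1 mul0r subr0.
(* Invertibility of a series is by definition that of its constant coefficient. *)
have : coefs (1 - fpsX * f) 0 \is a GRing.unit by rewrite c0 unitr1.
by [].
Qed.

Lemma fps_one_subX_unit : (1 - fpsX : fps rat) \is a GRing.unit.
Proof. by rewrite -[fpsX]mulr1 fps_one_subX_mul_unit. Qed.

(** * Weakly monotone words *)

(** Splitting at the first [k] forces an empty prefix, so the series [F] satisfies
    [F = 1 + fpsX * F]. *)
Lemma word_gf_constant (k : nat) : word_gf k.+1 (all (pred1 k)) = (1 - fpsX)^-1.
Proof.
apply: (mulIr fps_one_subX_unit); rewrite mulVr ?fps_one_subX_unit //.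
rewrite mulrBr mulr1 [X in X - _](word_gf_split _ _ (@nilp nat) (all (pred1 k))).
  rewrite word_gf_nilp mul1r [fpsX * _]mulrC addrK -(word_gf_nilp k).
  by apply: eq_in_word_gf => -[//|a s] /= /andP[/ltn_eqF ->].
case=> [|a u] v /=; first by rewrite eqxx.
by case/andP=> /ltn_eqF ->.
Qed.

(** After [k], a weakly increasing word can only repeat [k]. *)
Lemma sorted_leq_split (k : nat) (u v : seq nat) :
    all (gtn k) u -> all (gtn k.+1) v ->
  sorted leq (u ++ k :: v) = sorted leq u && all (pred1 k) v.
Proof.
move=> uk vk; rewrite sorted_cat_cons; congr (_ && _).
  case: u uk => [|a u] // auk; rewrite /= rcons_path.
  by have /ltnW -> := allP auk _ (mem_last a u); rewrite andbT.
elim: v vk => //= a v IHv /andP[]; rewrite ltnS => ak /IHv <-.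
by case: ltngtP ak => // ->.
Qed.

(** In a weakly decreasing word no letter below [k] can precede [k]. *)
Lemma sorted_geq_split (k : nat) (u v : seq nat) :
    all (gtn k) u -> all (gtn k.+1) v ->
  sorted geq (u ++ k :: v) = nilp u && sorted geq v.
Proof.
move=> uk vk; rewrite sorted_cat_cons; case: u uk => [_|a u auk].
  by apply: path_min_sorted; apply: sub_all vk => c; rewrite /= ltnS.
have lt_last := allP auk _ (mem_last a u).
by rewrite /= rcons_path /= leqNgt [(_ < k)%N]lt_last andbF.
Qed.

Lemma word_gf_sorted_leq (k : nat) : word_gf k (sorted leq) = (1 - fpsX) ^- k.
Proof.
elim: k => [|k IHk]; first by rewrite expr0 invr1 word_gf0.
have U := fps_one_subX_unit.
rewrite (word_gf_split _ _ _ _ (sorted_leq_split k)) word_gf_constant IHk.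
(* With [G = (1 - fpsX) ^- k], what remains is [G + fpsX * (G / (1 - fpsX)) = G / (1 - fpsX)]. *)
apply: (mulIr U); rewrite exprSr invrM ?unitrX // mulrDl !mulrA mulrVK //.
by rewrite mulrBr mulr1 mulrC subrK [RHS]mulrC mulVKr.
Qed.

Lemma word_gf_sorted_geq (k : nat) : word_gf k (sorted geq) = (1 - fpsX) ^- k.
Proof.
elim: k => [|k IHk]; first by rewrite expr0 invr1 word_gf0.
have U := fps_one_subX_unit; apply: (mulIr U).
(* Here the unknown series recurs on the right: [F_(k+1) = F_k + x F_(k+1)]. *)
rewrite mulrBr mulr1 [X in X - _](word_gf_split _ _ _ _ (sorted_geq_split k)).
rewrite word_gf_nilp mul1r [fpsX * _]mulrC addrK IHk.
by rewrite exprS invrM ?unitrX // mulrVK.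
Qed.

(** * Words avoiding a pattern *)

(* In both patterns the last letter exceeds the larger of the first two, so 12-3
   and 21-3 differ only in r, which is ltn for the former and gtn for the latter. *)
Fixpoint avoids (r : rel nat) (s : seq nat) : bool :=
  if s is a :: s' then
    (if s' is b :: t then r a b ==> all (geq (maxn a b)) t else true)
      && avoids r s'
  else true.

(** An adjacent pair involving the displayed [k] has maximum [k], which no later letter exceeds. A
    pair inside [u] is followed by [k], which exceeds both its letters, so it must not satisfy
    [r]. *)
Lemma avoids_split (r : rel nat) (k : nat) (u v : seq nat) :
    all (gtn k) u -> all (gtn k.+1) v ->
  avoids r (u ++ k :: v) = sorted (fun a b => ~~ r a b) u && avoids r v.
Proof.
move=> + vk; elim: u => [_|a u IHu /andP[ak uk]].
  case: v vk => //= b v /andP[_ vk].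
  case: (r k b) => //=; suff -> : all (geq (maxn k b)) v by [].
  apply: sub_all vk => c /=; rewrite ltnS => ck.
  exact: leq_trans ck (leq_maxl _ _).
rewrite [LHS]/= IHu //; case: u {IHu} uk => [_|b u /andP[bk _]].
  rewrite /=; suff -> : all (geq (maxn a k)) v by rewrite implybT.
  apply: sub_all vk => c /=; rewrite ltnS => ck.
  exact: leq_trans ck (leq_maxr _ _).
rewrite /= andbA; congr (_ && _ && _).
case: (r a b) => //=; apply/negbTE; rewrite all_cat /= negb_and.
by rewrite leqNgt gtn_max [(a < k)%N]ak [(b < k)%N]bk orbT.
Qed.

(** The head test covers [i = 0], the recursive call all other [i]. The default 0 is never read, as
    all indices are below [size s]. *)
Lemma avoidsP (r : rel nat) (s : seq nat) :
  reflect (forall i j, (i.+1 < j < size s)%N -> r (nth 0 s i) (nth 0 s i.+1) ->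
             nth 0 s j <= maxn (nth 0 s i) (nth 0 s i.+1))%N
          (avoids r s).
Proof.
elim: s => [|a s IHs]; first by constructor=> i j /andP[].
rewrite /= andbC; apply: (iffP andP) => [[/IHs avs av_a] [|i] [|j] //=|avs].
- case: s {IHs avs} av_a j => [|b s] //= /implyP av_a [|j] //= js /av_a.
  by move=> /(all_nthP 0%N); apply.
- by rewrite !ltnS; apply: avs.
split.
  by apply/IHs => i j ij; apply: (avs i.+1 j.+1).
case: s {IHs} avs => //= b s avs; apply/implyP => rab.
by apply/(all_nthP 0%N) => j js; apply: (avs 0%N j.+2).
Qed.

(** Splitting gives [F_(k+1) (1 - x / (1 - x)^k) = F_k], hence one new factor of the product per
    letter. *)
Lemma word_gf_avoids (r : rel nat) :
    (forall k, word_gf k (sorted (fun a b => ~~ r a b)) = (1 - fpsX) ^- k) ->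
  forall k, word_gf k (avoids r) =
    \prod_(0 <= j < k) (1 / (1 - fpsX / (1 - fpsX) ^+ j)).
Proof.
move=> sortedE; elim=> [|k IHk]; first by rewrite big_geq // word_gf0.
have U := fps_one_subX_mul_unit ((1 - fpsX) ^- k).
rewrite big_nat_recr //= -IHk mul1r; apply: (mulIr U); rewrite mulrVK //.
rewrite mulrBr mulr1 [X in X - _](word_gf_split _ _ _ _ (avoids_split r k)).
by rewrite sortedE mulrA [_ * (fpsX * _)]mulrC addrK.
Qed.

Lemma word_gf_avoids_ltn (k : nat) : word_gf k (avoids ltn) =
  \prod_(0 <= j < k) (1 / (1 - fpsX / (1 - fpsX) ^+ j)).
Proof.
(* Words without a strict ascent are the weakly decreasing ones. *)
apply: word_gf_avoids => {}k; rewrite -word_gf_sorted_geq.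
by apply: eq_in_word_gf => s _; apply: eq_sorted => a b /=; rewrite -leqNgt.
Qed.

Lemma word_gf_avoids_gtn (k : nat) : word_gf k (avoids gtn) =
  \prod_(0 <= j < k) (1 / (1 - fpsX / (1 - fpsX) ^+ j)).
Proof.
(* Words without a strict descent are the weakly increasing ones. *)
apply: word_gf_avoids => {}k; rewrite -word_gf_sorted_leq.
by apply: eq_in_word_gf => s _; apply: eq_sorted => a b /=; rewrite -leqNgt.
Qed.

(** * From patterns in tuples to predicates on sequences *)

Lemma exists_adjacent_avoids (r : rel nat) (k n : nat) (w : n.-tuple 'I_k) :
  [exists i : 'I_n, exists i1 : 'I_n, exists j : 'I_n,
    [&& i1 == i.+1 :> nat, i.+1 < j, r (tnth w i) (tnth w i1)
      & maxn (tnth w i) (tnth w i1) < tnth w j]]%N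
  = ~~ avoids r (map val w).
Proof.
have nthE (i : 'I_n) : nth 0%N (map val w) i = tnth w i.
  by rewrite -(tnth_nth _ [tuple of map val w]) tnth_map.
apply/idP/negP => [/'exists_'exists_existsP[i [i1 [j]]] /and4P[/eqP i1E ij rii]|].
  rewrite ltnNge => /negP + /avoidsP avw; apply.
  rewrite -!nthE i1E; apply: avw; first by rewrite ij size_map size_tuple /=.
  by rewrite -i1E !nthE.
apply: contra_notT => noocc; apply/avoidsP => i j; rewrite size_map size_tuple.
move=> /andP[ij jn]; have i1n := ltn_trans ij jn.
have in_ : (i < n)%N := ltnW i1n.
rewrite -[i]/(val (Ordinal in_)) -[i.+1]/(val (Ordinal i1n)).
rewrite -[j]/(val (Ordinal jn)) !nthE => rii; rewrite leqNgt.
apply: contra noocc => lt_max; apply/existsP; exists (Ordinal in_).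
apply/existsP; exists (Ordinal i1n); apply/existsP; exists (Ordinal jn).
by rewrite eqxx ij rii lt_max.
Qed.

Lemma contains_12_3E (k n : nat) (w : n.-tuple 'I_k) :
  contains_12_3 w = ~~ avoids ltn (map val w).
Proof.
rewrite -exists_adjacent_avoids; do 2!apply: eq_existsb => ?.
apply: eq_existsb => j; congr [&& _, _ & _].
(* If the pair ascends, its maximum is its second letter; otherwise both sides are false. *)
by rewrite /=; case: ltnP => // /ltnW/maxn_idPr ->.
Qed.

Lemma contains_21_3E (k n : nat) (w : n.-tuple 'I_k) :
  contains_21_3 w = ~~ avoids gtn (map val w).
Proof.
rewrite -exists_adjacent_avoids; do 2!apply: eq_existsb => ?.
apply: eq_existsb => j; congr [&& _, _ & _].
by rewrite /=; case: ltnP => // /ltnW/maxn_idPl ->.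
Qed.

Lemma avoid_gfE (p : pattern) (r : rel nat) (k : nat) :
    (forall n (w : n.-tuple 'I_k), p k n w = ~~ avoids r (map val w)) ->
  avoid_gf p k = word_gf k (avoids r).
Proof.
move=> pE; apply: fpsP => n /=; rewrite -card_word_count.
by congr (_%:R); apply: eq_card => w; rewrite !inE pE negbK.
Qed.

Theorem theorem3p6 :
  wilf_equiv contains_12_3 contains_21_3 /\
  forall k : nat, (1 <= k)%N ->
    avoid_gf contains_12_3 k = avoid_gf contains_21_3 k /\
    avoid_gf contains_21_3 k =
      \prod_(0 <= j < k) (1 / (1 - fpsX / (1 - fpsX) ^+ j)).
Proof.
have gf12 k := avoid_gfE _ _ k (contains_12_3E k).
have gf21 k := avoid_gfE _ _ k (contains_21_3E k).
have gf_eq k : avoid_gf contains_12_3 k = avoid_gf contains_21_3 k.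
  by rewrite gf12 gf21 word_gf_avoids_ltn word_gf_avoids_gtn.
split=> [k n|k _]; last by rewrite gf_eq gf21 word_gf_avoids_gtn.
(* Wilf-equivalence follows by comparing coefficients, since distinct natural numbers stay distinct
   in the rationals. *)
have /(congr1 (fun f => coefs f n))/eqP := gf_eq k.
by rewrite /= Num.Theory.eqr_nat => /eqP.
Qed.
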